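(* Let $m,n\ge 1$ be integers, let $R=[0,m]\times[0,n]$, and consider any assignment of the states open/closed to the edges of the graph $G_d$. One of the following two events always occurs but not both: (i) The rectangle $R$ contains an open left right crossing. (ii) The rectangle $R$ contains a closed dual top bottom crossing. Also, one of the following two events always occurs but not both: (iii) The rectangle $R$ contains an open left right dual crossing. (iv) The rectangle $R$ contains a closed top bottom crossing.
   Context: $G$ is the graph whose vertices and edges are the corners and (unit length) edges of the axis-parallel unit squares centred at the points of $\mathbb{Z}^2$ (so its vertex set is $\mathbb{Z}^2+(\tfrac12,\tfrac12)$). $G_d$ is $G$ shifted by $(\tfrac12,\tfrac12)$, i.e. the square lattice with vertex set $\mathbb{Z}^2$ and nearest neighbour edges. $G$ is called the dual graph of $G_d$. Every edge of $G_d$ is either open or closed. Every edge $f$ of $G_d$ intersects perpendicularly a unique edge $e(f)$ of $G$ (its dual edge), and $e(f)$ is declared open if and only if $f$ is open (and closed otherwise). A self avoiding path is a sequence of distinct edges forming a simple (vertex-non-repeating) path in the graph; it may consist of a single edge. For $R=[0,m]\times[0,n]$ let $R_{left}=\{0\}\times[0,n]$, $R_{right}=\{m\}\times[0,n]$, $R_{top}=[0,m]\times\{n\}$, $R_{bottom}=[0,m]\times\{0\}$. Crossings in $G_d$: a self avoiding path $P=(e_1,\dots,e_k)$ in $G_d$ is a left right crossing of $R$ if (a) $e_1$ contains exactly one endvertex in $R_{left}$ and no other edge of $P$ intersects $R_{left}$; (b) $e_k$ contains exactly one endvertex in $R_{right}$ and no other edge of $P$ intersects $R_{right}$; (c) every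 edge $e_j$, $2\le j\le k-1$, has both its endvertices in $R$. It is an open (closed) left right crossing if every edge of $P$ is open (closed). Top bottom crossings are defined analogously, with $R_{top}$ and $R_{bottom}$ in place of $R_{left}$ and $R_{right}$. Dual crossings in $G$: an edge $f$ of $G$ is said to intersect the left (right, top, bottom) edge of $R$ if $f$ intersects some edge of $G_d$ contained in the left (right, top, bottom) edge of $R$. A self avoiding path $P_d=(f_1,\dots,f_l)$ in $G$ is a dual left right crossing of $R$ (equivalently ''left right dual crossing'') if $f_1$ intersects $R_{left}$, $f_l$ intersects $R_{right}$, and every other edge $f_j$, $2\le j\le l-1$, has both its endvertices in the interior of $R$. It is open (closed) if all its edges are open (closed). Dual top bottom crossings are defined analogously, with $R_{top}$ and $R_{bottom}$. *)

(* Defs.v *)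
From HB Require Import structures.
From mathcomp Require Import all_boot all_order all_algebra.
From mathcomp Require Import all_classical all_reals.
From mathcomp Require Import zify lra.

Set Implicit Arguments.
Unset Strict Implicit.
Unset Printing Implicit Defensive.

Import Order.TTheory GRing.Theory Num.Theory.
Local Open Scope classical_set_scope.
Local Open Scope ring_scope.

(** The plane is [R * R] with [R : realType].

    Both lattices are coded by the same combinatorial square lattice on
    [int * int] and differ only in where it is drawn in the plane: [position c]
    translates it by [(c, c)], where [c = 0] gives G_d and [c = 2^-1] gives its
    dual graph G.  An (undirected) edge is coded by its left (resp. lower)
    endvertex and its direction, so every edge has exactly one code. *)

Definition vertex : Type := int * int.

Inductive direction := Horizontal | Vertical.

Definition bool_of_direction (d : direction) : bool :=
  if d is Horizontal then true else false.
Definition direction_of_bool (b : bool) : direction :=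
  if b then Horizontal else Vertical.
Lemma bool_of_directionK : cancel bool_of_direction direction_of_bool.
Proof. by case. Qed.
HB.instance Definition _ := Equality.copy direction (can_type bool_of_directionK).

Definition edge : Type := vertex * direction.

Definition start_vertex (e : edge) : vertex := e.1.

Definition end_vertex (e : edge) : vertex :=
  match e.2 with
  | Horizontal => (e.1.1 + 1, e.1.2)
  | Vertical => (e.1.1, e.1.2 + 1)
  end.

Definition endvertices (e : edge) : seq vertex :=
  [:: start_vertex e; end_vertex e].

Definition position (R : realType) (c : R) (v : vertex) : R * R :=
  (v.1%:~R + c, v.2%:~R + c).

Definition segment (R : realType) (c : R) (e : edge) : set (R * R) :=
  let a := position c (start_vertex e) in
  let b := position c (end_vertex e) in
  [set p | exists2 t : R, 0 <= t <= 1 &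
     p = ((1 - t) * a.1 + t * b.1, (1 - t) * a.2 + t * b.2)].

Definition Gd_point (R : realType) (v : vertex) : R * R := position 0 v.
Definition Gd_segment (R : realType) (e : edge) : set (R * R) := segment 0 e.
Definition G_point (R : realType) (v : vertex) : R * R := position 2^-1 v.
Definition G_segment (R : realType) (e : edge) : set (R * R) := segment 2^-1 e.

Arguments Gd_point R v : clear implicits.
Arguments Gd_segment R e : clear implicits.
Arguments G_point R v : clear implicits.
Arguments G_segment R e : clear implicits.

(** Edge of G crossing perpendicularly the edge [f] of G_d; that it is the only
    edge of G meeting [f] is [meet_dual_edge] below. *)
Definition dual_edge (f : edge) : edge :=
  let: ((x, y), d) := f in
  match d with
  | Horizontal => ((x, y - 1), Vertical)
  | Vertical => ((x - 1, y), Horizontal)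
  end.

Definition primal_edge (g : edge) : edge :=
  let: ((x, y), d) := g in
  match d with
  | Horizontal => ((x + 1, y), Vertical)
  | Vertical => ((x, y + 1), Horizontal)
  end.

Lemma dual_edgeK : cancel dual_edge primal_edge.
Proof. by case=> [[x y] []] /=; rewrite subrK. Qed.

Lemma primal_edgeK : cancel primal_edge dual_edge.
Proof. by case=> [[x y] []] /=; rewrite addrK. Qed.

Lemma meet_dual_edge_aux (R : realType) (a b : int) (t : R) :
  a%:~R - b%:~R = t -> -1 < t < 1 -> a = b.
Proof.
move=> <- /andP[]; rewrite -rmorphB -[1]/(1%:~R) -rmorphN !ltr_int; lia.
Qed.

Lemma half_not_int (R : realType) (a b : int) : a%:~R <> b%:~R + 2^-1 :> R.
Proof.
move=> h; have : a%:~R *+ 2 = (b *+ 2 + 1)%:~R :> R.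
  by rewrite rmorphD rmorphMn /= h; lra.
by rewrite -rmorphMn /= => /(mulrIz (oner_neq0 R)); lia.
Qed.

Lemma meet_dual_edge (R : realType) (f g : edge) :
  (Gd_segment R f `&` G_segment R g) !=set0 <-> g = dual_edge f.
Proof.
case: f => [[x y] d]; case: g => [[a b] d']; split; last first.
  move=> ->; case: d; rewrite /Gd_segment /G_segment /segment /=.
    exists (x%:~R + 2^-1, y%:~R); split; exists 2^-1; rewrite ?rmorphD ?rmorphN //=;
      try (apply/andP; split); try congr pair; lra.
  exists (x%:~R, y%:~R + 2^-1); split; exists 2^-1; rewrite ?rmorphD ?rmorphN //=;
    try (apply/andP; split); try congr pair; lra.
case=> p [] [t /andP[t0 t1] ->] [s /andP[s0 s1]].
case: d; case: d'; rewrite /position /= ?rmorphD /= => -[h1 h2].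
- by case: (@half_not_int R y b); lra.
- have -> : a = x by apply: (meet_dual_edge_aux (t := t - 2^-1 : R)); lra.
  suff -> : b = y - 1 by [].
  apply: (meet_dual_edge_aux (t := 2^-1 - s : R)); last lra.
  rewrite rmorphB /=; lra.
- have -> : b = y by apply: (meet_dual_edge_aux (t := t - 2^-1 : R)); lra.
  suff -> : a = x - 1 by [].
  apply: (meet_dual_edge_aux (t := 2^-1 - s : R)); last lra.
  rewrite rmorphB /=; lra.
- by case: (@half_not_int R x a); lra.
Qed.

(** A configuration on G_d: [true] is open, [false] is closed. *)
Definition configuration : Type := edge -> bool.

Definition dual_configuration (st : configuration) : configuration :=
  fun g => st (primal_edge g).

Lemma dual_configurationE (st : configuration) (f : edge) :
  dual_configuration st (dual_edge f) = st f.
Proof. by rewrite /dual_configuration dual_edgeK. Qed.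

Definition all_open (st : configuration) (P : seq edge) : Prop :=
  forall e, e \in P -> st e = true.

Definition all_closed (st : configuration) (P : seq edge) : Prop :=
  forall e, e \in P -> st e = false.

Definition joins (e : edge) (u v : vertex) : bool :=
  (endvertices e == [:: u; v]) || (endvertices e == [:: v; u]).

Fixpoint walk (v : vertex) (vs : seq vertex) (P : seq edge) : bool :=
  match vs, P with
  | [::], [::] => true
  | w :: vs', e :: P' => joins e v w && walk w vs' P'
  | _, _ => false
  end.

Definition self_avoiding (P : seq edge) : Prop :=
  [/\ P <> [::], uniq P &
      exists v : vertex, exists vs : seq vertex, uniq (v :: vs) /\ walk v vs P].

(** The default value is never used on a (nonempty) self avoiding path. *)
Definition default_edge : edge := ((0, 0), Horizontal).
Definition first_edge (P : seq edge) : edge := head default_edge P.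
Definition last_edge (P : seq edge) : edge := last default_edge P.

Section Rectangle.
Variables (R : realType) (m n : nat).

Definition rectangle : set (R * R) := `[0, m%:R] `*` `[0, n%:R].
Definition rectangle_interior : set (R * R) := `]0, m%:R[ `*` `]0, n%:R[.
Definition left_side : set (R * R) := [set 0] `*` `[0, n%:R].
Definition right_side : set (R * R) := [set m%:R] `*` `[0, n%:R].
Definition top_side : set (R * R) := `[0, m%:R] `*` [set n%:R].
Definition bottom_side : set (R * R) := `[0, m%:R] `*` [set 0].

Definition one_endvertex_in (e : edge) (A : set (R * R)) : Prop :=
  exists! v : vertex, v \in endvertices e /\ A (Gd_point R v).

Definition Gd_intersects (e : edge) (A : set (R * R)) : Prop :=
  (Gd_segment R e `&` A) !=set0.

Definition G_intersects (f : edge) (A : set (R * R)) : Prop :=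
  exists e : edge, Gd_segment R e `<=` A /\
    (G_segment R f `&` Gd_segment R e) !=set0.

(** Crossing in G_d from the side [A] to the side [B].  As the edges of a self
    avoiding path are distinct, "other edge of P" is stated by membership. *)
Definition crossing (A B : set (R * R)) (P : seq edge) : Prop :=
  [/\ self_avoiding P,
      one_endvertex_in (first_edge P) A /\
        (forall e, e \in P -> e != first_edge P -> ~ Gd_intersects e A),
      one_endvertex_in (last_edge P) B /\
        (forall e, e \in P -> e != last_edge P -> ~ Gd_intersects e B) &
      forall e, e \in P -> e != first_edge P -> e != last_edge P ->
        forall v, v \in endvertices e -> rectangle (Gd_point R v)].

Definition dual_crossing (A B : set (R * R)) (P : seq edge) : Prop :=
  [/\ self_avoiding P,
      G_intersects (first_edge P) A,
      G_intersects (last_edge P) B &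
      forall f, f \in P -> f != first_edge P -> f != last_edge P ->
        forall v, v \in endvertices f -> rectangle_interior (G_point R v)].

Definition left_right_crossing := crossing left_side right_side.
Definition top_bottom_crossing := crossing top_side bottom_side.
Definition dual_left_right_crossing := dual_crossing left_side right_side.
Definition dual_top_bottom_crossing := dual_crossing top_side bottom_side.

End Rectangle.

Definition exactly_one (A B : Prop) : Prop := (A \/ B) /\ ~ (A /\ B).

(* Main.v *)
(** Existence: call a set [s] of vertices a cut if it contains the first side, avoids the
    second and is stable under the usable edges; without a crossing there is a cut.  If
    both the open crossing and the closed dual crossing were missing, take a cut [s] of the
    lattice and a cut [t] of the dual lattice, modulo 2.  The increments of [s] around
    every face sum to 0, so they still do when weighted by [t] and summed over all faces.
    An edge across which [s] changes is closed, so [t] is constant along its dual, and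
    summation by parts leaves only the increments of [s] along the top side; these sum to
    1 because [s] changes between the left and the right side.

    Exclusion: for a dual path from top to bottom, the parity of the number of its edges
    met between the left side and a vertex is 0 on the left side, 1 on the right side,
    and changes only across edges dual to the path, so an open crossing would contain such
    an edge, which is both open and closed.

    The second dichotomy is the first one for the transposed rectangle with open and
    closed exchanged. *)

Require Import Defs.
From mathcomp Require Import all_boot all_order all_algebra.
From mathcomp Require Import all_classical all_reals.
From mathcomp Require Import zify lra.

Set Implicit Arguments.
Unset Strict Implicit.
Unset Printing Implicit Defensive.

Import Order.TTheory GRing.Theory Num.Theory.
Local Open Scope classical_set_scope.
Local Open Scope ring_scope.

(** * Paths and cuts *)

Lemma joins_sym (e : edge) (u v : vertex) : joins e u v = joins e v u.
Proof. by rewrite /joins orbC. Qed.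

Lemma joinsE (e : edge) (u v : vertex) : joins e u v ->
  (u = start_vertex e /\ v = end_vertex e) \/
  (u = end_vertex e /\ v = start_vertex e).
Proof.
by rewrite /joins => /orP[] /eqP; rewrite /endvertices => -[-> ->];
  [left | right].
Qed.

Lemma joins_mem (e : edge) (u v : vertex) : joins e u v ->
  endvertices e =i [:: u; v].
Proof.
by move=> /orP[] /eqP -> x //; rewrite !inE orbC.
Qed.

Lemma walk_mem (v x : vertex) (vs : seq vertex) (P : seq edge) (e : edge) :
  walk v vs P -> e \in P -> x \in endvertices e -> x \in v :: vs.
Proof.
elim: vs v P => [|w vs IH] v [|f P] //= /andP[ef wP].
rewrite inE => /predU1P[-> | eP xe]; last by rewrite inE (IH _ _ wP eP xe) orbT.
by rewrite (joins_mem ef) !inE => /orP[] ->; rewrite ?orbT.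
Qed.

Lemma walk_uniq (v : vertex) (vs : seq vertex) (P : seq edge) :
  uniq (v :: vs) -> walk v vs P -> uniq P.
Proof.
elim: vs v P => [|w vs IH] v [|f P] // /andP[vvs uvs] /andP[ef wP].
rewrite cons_uniq (IH _ _ uvs wP) andbT.
apply: contra vvs => fP; apply: (walk_mem wP fP).
by rewrite (joins_mem ef) inE eqxx.
Qed.

Lemma walk_nth (v : vertex) (vs : seq vertex) (P : seq edge) : walk v vs P ->
  size vs = size P /\
  forall i, (i < size P)%N ->
    joins (nth default_edge P i) (nth v (v :: vs) i) (nth v (v :: vs) i.+1).
Proof.
have gen x0 : walk v vs P -> size vs = size P /\
  forall i, (i < size P)%N ->
    joins (nth default_edge P i) (nth x0 (v :: vs) i) (nth x0 (v :: vs) i.+1).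
  elim: vs v P => [|w vs IH] v [|f P] //= /andP[ef wP].
  by have [-> h] := IH _ _ wP; split=> // -[|i] //= /h.
exact: gen.
Qed.

Lemma walk_cat (v : vertex) (vs ws : seq vertex) (P Q : seq edge) :
  walk v vs P -> walk (last v vs) ws Q -> walk v (vs ++ ws) (P ++ Q).
Proof.
elim: vs v P => [|w vs IH] v [|f P] //= /andP[-> wP] wQ /=; exact: IH.
Qed.

Lemma walk_rev (v : vertex) (vs : seq vertex) (P : seq edge) :
  walk v vs P -> walk (last v vs) (rev (belast v vs)) (rev P).
Proof.
elim: vs v P => [|w vs IH] v [|f P] //= /andP[ef wP].
rewrite !rev_cons -!cats1; apply: walk_cat (IH _ _ wP) _ => /=.
rewrite andbT joins_sym; suff -> : last (last w vs) (rev (belast w vs)) = w by [].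
by case: (vs) => //= a l; rewrite rev_cons last_rcons.
Qed.

Lemma self_avoiding_rev (P : seq edge) : self_avoiding P -> self_avoiding (rev P).
Proof.
case=> P0 uP [v [vs [uvs wP]]]; split.
- by move/(congr1 rev); rewrite revK.
- by rewrite rev_uniq.
- exists (last v vs), (rev (belast v vs)); split; last exact: walk_rev.
  by rewrite -rev_rcons -lastI rev_uniq.
Qed.

(** Numbering the vertices turns the conditions on first, last and middle edges of a crossing into
    conditions on an index: [A] is met at index 0 only, [B] at index [size P] only. *)
Definition link (A B : pred vertex) (P : seq edge) : Prop :=
  exists f : nat -> vertex,
  [/\ self_avoiding P,
      A (f 0%N) /\ (forall i, (0 < i <= size P)%N -> ~~ A (f i)),
      B (f (size P)) /\ (forall i, (i < size P)%N -> ~~ B (f i)) &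
      forall i, (i < size P)%N -> joins (nth default_edge P i) (f i) (f i.+1)].

(** The candidate cut [s] consists of the vertices reachable from [A] along usable edges. If it
    meets [B], removing loops from a route gives a link; otherwise [s] is a cut. *)
Lemma link_or_cut (E : pred edge) (A B : pred vertex) :
  (forall v, A v -> ~~ B v) ->
  (exists2 P, link A B P & all E P) \/
  (exists s : pred vertex,
    [/\ forall v, A v -> s v, forall v, B v -> ~~ s v &
        forall e, E e -> s (start_vertex e) = s (end_vertex e)]).
Proof.
move=> AB.
(* A step neither leaves [B] nor enters [A], so a route from [A] to [B] meets [A] only at its start
   and [B] only at its end. *)
pose step u v := [&& ~~ B u, ~~ A v & `[< exists2 e, E e & joins e u v >]].
pose s := fun v => `[< exists a p, [/\ A a, path step a p & last a p = v] >].
have [[b Bb /asboolP[a [p0 [Aa pp0 lp0]]]]|no_b] := pselect (exists2 b, B b & s b).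
  left; move: lp0; case/shortenP: pp0 => p pp up _ lp.
  have [P wP EP] : exists2 P, walk a p P & all E P.
    elim: p a {Aa up lp} pp => [|w p IH] a /=; first by exists [::].
    move=> /andP[/and3P[_ _ /asboolP[e Ee ea]] /IH[P wP EP]].
    by exists (e :: P); rewrite /= ?ea ?Ee.
  have [szP jP] := walk_nth wP; have uP := walk_uniq up wP.
  exists P => //; exists (nth a (a :: p)); split=> //.
  - split=> //; last by exists a, p.
    move=> P0; move: wP lp; rewrite P0; case: (p) => //= _ ab.
    by move: (AB _ Aa); rewrite ab Bb.
  - split=> // -[|i] //=; rewrite -szP => ip.
    have /(pathP a)/(_ i ip) := pp.
    by case/and3P.
  - rewrite -szP -[nth _ _ _]/(nth a (a :: p) (size (a :: p)).-1) nth_last /= lp.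
    split=> // i ip; have /(pathP a)/(_ i ip) := pp.
    by case/and3P.
right; exists s; split.
- by move=> v Av; apply/asboolP; exists v, [::].
- by move=> v Bv; apply/negP => sv; apply: no_b; exists v.
(* The restrictions on steps do not hinder stability: vertices of [A] are reached by the empty
   route, and [u] is outside [B] because [s] misses [B]. *)
- have ext e u v : E e -> joins e u v -> s u -> s v.
    move=> Ee uv su; have [Av | nAv] := boolP (A v).
      by apply/asboolP; exists v, [::].
    have nBu : ~~ B u by apply/negP => Bu; apply: no_b; exists u.
    have /asboolP[a [p [Aa pp lp]]] := su; apply/asboolP; exists a, (rcons p v).
    rewrite last_rcons rcons_path pp lp; split=> //.
    by rewrite /step nBu nAv; apply/asboolP; exists e.
  move=> e Ee; have j : joins e (start_vertex e) (end_vertex e).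
    by rewrite /joins eqxx.
  apply/idP/idP; first exact: ext j.
  by apply: ext Ee _; rewrite joins_sym.
Qed.

(** * Parity arguments *)

Lemma telescope_addb (f : nat -> bool) (k : nat) :
  \big[addb/false]_(i < k) (f i (+) f i.+1) = f 0%N (+) f k.
Proof.
elim: k => [|k IH]; first by rewrite big_ord0 addbb.
by rewrite big_ord_recr /= IH -addbA (addbA (f k)) addbb addFb.
Qed.

(* Rows [-1] and [n] of the dual lattice are joined to the rest by vertical edges only. *)
Definition dual_usable (m n : nat) : pred edge :=
  [pred g | match g with
            | ((x, y), Horizontal) =>
                (0 <= x) && (x + 1 < m%:Z) && (0 <= y < n%:Z)
            | ((x, y), Vertical) => (0 <= x < m%:Z) && (-1 <= y < n%:Z)
            end].

(** The dual vertex [(x, y)] is the centre of the unit square with lower left corner [(x, y)]. The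
    weighted increments of [s] cancel around each square, yet their sum over all squares, taken by
    rows and columns, is 1. *)
Lemma no_two_cuts (m n : nat) (s t : pred vertex) :
  (forall y : int, 0 <= y <= n%:Z -> s (0, y)) ->
  (forall y : int, 0 <= y <= n%:Z -> ~~ s (m%:Z, y)) ->
  (forall x : int, 0 <= x < m%:Z -> t (x, n%:Z)) ->
  (forall x : int, 0 <= x < m%:Z -> ~~ t (x, -1)) ->
  (forall g, dual_usable m n g ->
    s (start_vertex (primal_edge g)) != s (end_vertex (primal_edge g)) ->
    t (start_vertex g) = t (end_vertex g)) ->
  False.
Proof.
move=> sL sR tT tB st_const.
have Sz (k : nat) : k.+1%:Z = k%:Z + 1 :> int by lia.
(* [a i j] and [b i j] weight the dual edges below and to the left of the face [(i, j)]. *)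
pose a (i j : nat) := t (i%:Z, j%:Z) && (s (i%:Z, j%:Z) (+) s (i%:Z + 1, j%:Z)).
pose b (i j : nat) :=
  [&& (i < m)%N, t (i%:Z, j%:Z) & s (i%:Z, j%:Z) (+) s (i%:Z, j%:Z + 1)].
(* Where [s] changes along the top edge of a square, [t] agrees on both sides of that edge, so the
   weight of the square itself may be used. [bS] does the same for the right edge. *)
have aS i j : (i < m)%N -> (j < n)%N ->
    a i j.+1 = t (i%:Z, j%:Z) && (s (i%:Z, j%:Z + 1) (+) s (i%:Z + 1, j%:Z + 1)).
  move=> im jn; rewrite /a Sz.
  have := st_const ((i%:Z, j%:Z), Vertical); rewrite /dual_usable /start_vertex /end_vertex /=.
  by case: (s _) => /=; case: (s _) => /=; rewrite ?andbT ?andbF // => -> //; lia.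
have bS i j : (i < m)%N -> (j < n)%N ->
    b i.+1 j = t (i%:Z, j%:Z) && (s (i%:Z + 1, j%:Z) (+) s (i%:Z + 1, j%:Z + 1)).
  move=> im jn; rewrite /b Sz.
  have [im1|im1] := ltnP (i + 1) m.
    have := st_const ((i%:Z, j%:Z), Horizontal).
    rewrite /dual_usable /start_vertex /end_vertex /=.
    by case: (s _) => /=; case: (s _) => /=; rewrite ?andbT ?andbF // => -> //; lia.
  (* In the last column both sides vanish, since [s] is false on the whole right side. *)
  have -> : i%:Z + 1 = m%:Z by lia.
  by rewrite !(negbTE (sR _ _)) ?andbF //; lia.
have face i j : (i < m)%N -> (j < n)%N ->
    (a i j (+) a i j.+1) (+) (b i j (+) b i.+1 j) = false.
  move=> im jn; rewrite aS // bS // /a /b im /=.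
  by case: (t _) => //=; do 4 case: (s _).
(* Along a row only [b 0 j] and [b m j] survive: the first is false because [s] is constant on the
   left side, the second by the guard [i < m]. *)
have sumb j : (j < n)%N -> \big[addb/false]_(i < m) (b i j (+) b i.+1 j) = false.
  move=> jn; rewrite (telescope_addb (b^~ j)) /b ltnn /= addbF.
  by case: (0 < m)%N => //=; rewrite !sL ?andbF //; lia.
(* Up a column only the top term survives: at the bottom [t (i, -1)] is false, and [t (i, 0)] agrees
   with it wherever [s] changes. *)
have suma i : (i < m)%N -> \big[addb/false]_(j < n) (a i j (+) a i j.+1) =
    (s (i%:Z, n%:Z) (+) s (i.+1%:Z, n%:Z)).
  move=> im; rewrite (telescope_addb (a i)) /a tT; last by lia.
  rewrite Sz andTb; suff -> : t (i%:Z, 0%:Z) &&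
    (s (i%:Z, 0%:Z) (+) s (i%:Z + 1, 0%:Z)) = false by [].
  have := st_const ((i%:Z, -1), Vertical); rewrite /dual_usable /start_vertex /end_vertex /=.
  have /negbTE -> : ~~ t (i%:Z, -1) by apply: tB; lia.
  rewrite addNr; change (Posz 0) with (0 : int).
  by case: (s _) => /=; case: (s _) => /=; rewrite ?andbT ?andbF // => <- //; lia.
have : \big[addb/false]_(i < m) \big[addb/false]_(j < n)
    ((a i j (+) a i j.+1) (+) (b i j (+) b i.+1 j)) = false.
  by apply: big1 => i _; apply: big1 => j _; apply: face.
under eq_bigr do rewrite big_split.
rewrite big_split /= [X in _ (+) X]exchange_big /=.
rewrite [X in _ (+) X]big1 => [|j _]; last exact: sumb.
under eq_bigr do rewrite suma //.
rewrite (telescope_addb (fun i => s (i%:Z, n%:Z))) sL; last by lia.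
by rewrite (negbTE (sR _ _)) //; lia.
Qed.

(** The increment is symmetric in the two endvertices, so the sum telescopes in whichever sense each
    edge is traversed. *)
Lemma walk_parity (S : pred vertex) (v : vertex) (vs : seq vertex) (P : seq edge) :
  walk v vs P ->
  \big[addb/false]_(e <- P) (S (start_vertex e) (+) S (end_vertex e)) =
  S v (+) S (last v vs).
Proof.
elim: vs v P => [|w vs IH] v [|e P] //=; first by rewrite big_nil addbb.
move=> /andP[/joinsE ev wP]; rewrite big_cons (IH _ _ wP).
case: ev => -[-> ->]; case: (S (start_vertex e)) => /=;
  case: (S (end_vertex e)) => //=; by rewrite ?negbK.
Qed.

Definition primal_usable (m n : nat) : pred edge :=
  [pred e | all [pred v | (0 <= v.1 <= m%:Z) && (0 <= v.2 <= n%:Z)] (endvertices e)].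

(* [c u] is the parity of the number of edges of [Q] met on the way from the left side to [u]
   along its row. *)
Lemma dual_walk_coloring (m n : nat) (v : vertex) (vs : seq vertex) (Q : seq edge) :
  walk v vs Q -> all (dual_usable m n) Q -> v.2 = n%:Z -> (last v vs).2 = -1 ->
  exists c : pred vertex,
  [/\ forall y : int, c (0, y) = false,
      forall y : int, 0 <= y <= n%:Z -> c (m%:Z, y) &
      forall e, primal_usable m n e -> dual_edge e \notin Q ->
        c (start_vertex e) = c (end_vertex e)].
Proof.
move=> wQ uQ vn lvs.
have HV : (Horizontal == Vertical) = false by [].
have VH : (Vertical == Horizontal) = false by [].
(* A vertical dual edge starting in row [u.2 - 1] cuts the row of [u] half a unit to the right of
   its first coordinate. *)
pose hit (u : vertex) (g : edge) :=
  [&& ~~ bool_of_direction g.2, g.1.2 == u.2 - 1 & 0 <= g.1.1 < u.1].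
exists (fun u => \big[addb/false]_(g <- Q) hit u g); split.
- by move=> y; apply: big1_seq => -[[a b] d] _; rewrite /hit /=; lia.
(* On the right side every cut of row [y] counts. Dual row [j] has height [j + 1/2], so [y <= j]
   means above row [y]; the walk passes from above to below, hence an odd number of times. *)
- move=> y yn /=; suff -> : \big[addb/false]_(g <- Q) hit (m%:Z, y) g =
      \big[addb/false]_(g <- Q) ((y <= (start_vertex g).2) (+) (y <= (end_vertex g).2)).
    by rewrite (walk_parity (fun u => y <= u.2) wQ) vn lvs; lia.
  apply: eq_big_seq => -[[a b] d] /(allP uQ).
  by case: d; rewrite /dual_usable /hit /start_vertex /end_vertex /=; lia.
- move=> e eR eQ.
  suff : \big[addb/false]_(g <- Q) (hit (start_vertex e) g (+) hit (end_vertex e) g) = false.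
    by rewrite big_split /= => /negbT; rewrite -negb_eqb negbK => /eqP.
  case: e eR eQ => [[x y] []] eR eQ.
    (* Only the dual of a horizontal edge can be hit from one of its ends and not from the other,
       and that dual is excluded. *)
    apply: big1_seq => g /= gQ; have : g != dual_edge ((x, y), Horizontal).
      by apply: contraNneq eQ => <-.
    move: eR (allP uQ g gQ); case: g {gQ} => [[a b] []];
    rewrite /primal_usable /dual_usable /hit /start_vertex /end_vertex /=
      !xpair_eqE ?eqxx ?HV ?VH /=; lia.
  (* For a vertical edge, the hits from its two ends are together the edges of [Q] leaving the set
     of dual vertices of row [y] left of column [x]; the only horizontal candidate is the excluded
     dual. Both ends of the walk are outside this set, so their number is even. *)
  transitivity (\big[addb/false]_(g <- Q)
     (((start_vertex g).2 == y) && ((start_vertex g).1 < x) (+)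
      ((end_vertex g).2 == y) && ((end_vertex g).1 < x))); last first.
    rewrite (walk_parity (fun u => (u.2 == y) && (u.1 < x)) wQ) vn lvs.
    by move: eR; rewrite /primal_usable /start_vertex /end_vertex /=; lia.
  apply: eq_big_seq => g gQ; have : g != dual_edge ((x, y), Vertical).
    by apply: contraNneq eQ => <-.
  move: eR (allP uQ g gQ); case: g {gQ} => [[a b] []];
  rewrite /primal_usable /dual_usable /hit /start_vertex /end_vertex /=
      !xpair_eqE ?eqxx ?HV ?VH /=; lia.
Qed.

(** * Lattice points and the rectangle *)

Lemma ler_int_nat (R : realType) (a : int) (k : nat) :
  (a%:~R <= k%:R :> R) = (a <= k%:Z).
Proof. exact: (ler_int R a k%:Z). Qed.

Lemma eqr_int_nat (R : realType) (a : int) (k : nat) :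
  (a%:~R = k%:R :> R) <-> (a == k%:Z).
Proof. by rewrite -(eqr_int R a k%:Z); split=> /eqP. Qed.

Lemma eqr_int0 (R : realType) (a : int) : (a%:~R = 0 :> R) <-> (a == 0).
Proof. by rewrite -(intr_eq0 R a); split=> /eqP. Qed.

Lemma rectangleE (R : realType) (m n : nat) (v : vertex) :
  rectangle m n (Gd_point R v) <-> (0 <= v.1 <= m%:Z) && (0 <= v.2 <= n%:Z).
Proof.
rewrite /rectangle /Gd_point /position !addr0 /= !in_itv /= !ler0z !ler_int_nat.
by split=> [[-> ->] | /andP].
Qed.

Lemma left_sideE (R : realType) (n : nat) (v : vertex) :
  left_side n (Gd_point R v) <-> (v.1 == 0) && (0 <= v.2 <= n%:Z).
Proof.
rewrite /left_side /Gd_point /position !addr0 /= !in_itv /= !ler0z !ler_int_nat.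
by rewrite eqr_int0; split=> [[-> ->] | /andP].
Qed.

Lemma right_sideE (R : realType) (m n : nat) (v : vertex) :
  right_side m n (Gd_point R v) <-> (v.1 == m%:Z) && (0 <= v.2 <= n%:Z).
Proof.
rewrite /right_side /Gd_point /position !addr0 /= !in_itv /= !ler0z !ler_int_nat.
by rewrite eqr_int_nat; split=> [[-> ->] | /andP].
Qed.

Lemma interiorE (R : realType) (m n : nat) (v : vertex) :
  rectangle_interior m n (G_point R v) <-> (0 <= v.1 < m%:Z) && (0 <= v.2 < n%:Z).
Proof.
have pos (a : int) : (0 < a%:~R + 2^-1 :> R) = (0 <= a).
  apply/idP/idP => [|a0]; last by have : (0 : R) <= a%:~R; [rewrite ler0z | lra].
  rewrite (leNgt 0 a); apply: contraTN => a0.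
  have : (a + 1)%:~R <= (0 : R) by rewrite lerz0; lia.
  by rewrite rmorphD /= -leNgt; lra.
have lt (a : int) (k : nat) : (a%:~R + 2^-1 < k%:R :> R) = (a < k%:Z).
  apply/idP/idP => [|ak].
    rewrite (ltNge a); apply: contraTN => ka.
    have : k%:R <= (a%:~R : R) := etrans (ler_int R k%:Z a) ka.
    by rewrite -leNgt; lra.
  have : (a + 1)%:~R <= (k%:R : R) by rewrite ler_int_nat; lia.
  by rewrite rmorphD /=; lra.
rewrite /rectangle_interior /G_point /position /= !in_itv /= !pos !lt.
by split=> [[-> ->] | /andP].
Qed.

Lemma segment_start (R : realType) (c : R) (e : edge) :
  segment c e (position c (start_vertex e)).
Proof.
exists 0; first by rewrite lexx ler01.
by rewrite subr0 !mul1r !mul0r !addr0; case: (position _ _).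
Qed.

Lemma segment_end (R : realType) (c : R) (e : edge) :
  segment c e (position c (end_vertex e)).
Proof.
exists 1; first by rewrite lexx ler01.
by rewrite subrr !mul1r !mul0r !add0r; case: (position _ _).
Qed.

Lemma endvertex_segment (R : realType) (c : R) (e : edge) (v : vertex) :
  v \in endvertices e -> segment c e (position c v).
Proof.
by rewrite !inE => /orP[] /eqP ->; [apply: segment_start | apply: segment_end].
Qed.

Lemma segment_left (R : realType) (n : nat) (e : edge) :
  (forall v, v \in endvertices e -> 0 < v.1) -> ~ Gd_intersects e (left_side (R:=R) n).
Proof.
move=> h [p [[t /andP[t0 t1] ->]]] [/= + _]; rewrite !addr0.
have /h : start_vertex e \in endvertices e by rewrite mem_head.
have /h : end_vertex e \in endvertices e by rewrite !inE eqxx orbT.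
rewrite -!(ltr0z R); nra.
Qed.

Lemma segment_right (R : realType) (m n : nat) (e : edge) :
  (forall v, v \in endvertices e -> v.1 < m%:Z) ->
  ~ Gd_intersects e (right_side (R:=R) m n).
Proof.
move=> h [p [[t /andP[t0 t1] ->]]] [/= + _]; rewrite !addr0.
have /h : start_vertex e \in endvertices e by rewrite mem_head.
have /h : end_vertex e \in endvertices e by rewrite !inE eqxx orbT.
(* By integrality both first coordinates are at most [m - 1], hence so is every convex
   combination. *)
rewrite -!lezD1 -!(ler_int_nat R) !rmorphD /= !mulr1z.
set a := (start_vertex e).1%:~R; set b := (end_vertex e).1%:~R.
move=> bm am; have : 0 <= t * (m%:R - b - 1) by apply: mulr_ge0; lra.
have : 0 <= (1 - t) * (m%:R - a - 1) by apply: mulr_ge0; lra.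
lra.
Qed.

Lemma segment_horizontal (R : realType) (m : nat) (c : R) (e : edge) :
  segment 0 e `<=` `[0, m%:R] `*` [set c] <->
  [/\ e.2 = Horizontal, e.1.2%:~R = c, 0 <= e.1.1 & e.1.1 < m%:Z].
Proof.
split=> [sub|].
  have := sub _ (segment_start 0 e); have := sub _ (segment_end 0 e).
  case: e {sub} => [[x y] []]; rewrite /position /= !in_itv /= !addr0.
    rewrite !ler0z !ler_int_nat => -[h1 h2] [h3 h4]; split=> //; lia.
  by rewrite rmorphD /= => -[_ <-] [_ /eqP]; rewrite eq_sym -subr_eq0 addrAC subrr add0r oner_eq0.
case: e => [[x y] d] /= [-> <- x0 xm] p [t /andP[t0 t1] ->].
rewrite /= !in_itv /= !addr0 /=; split; last lra.
have : (0 : R) <= x%:~R by rewrite ler0z.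
have : (x + 1)%:~R <= (m%:R : R) by rewrite ler_int_nat; lia.
by rewrite rmorphD /=; nra.
Qed.

(** * Crossings and walks *)

Definition left_vertex (n : nat) : pred vertex :=
  [pred v | (v.1 == 0) && (0 <= v.2 <= n%:Z)].
Definition right_vertex (m n : nat) : pred vertex :=
  [pred v | (v.1 == m%:Z) && (0 <= v.2 <= n%:Z)].
(** Dual rows [n] and [-1] are drawn at heights [n + 1/2] and [-1/2]: they hold the outer ends of
    the dual edges cutting the top and bottom sides. *)
Definition dual_top_vertex (m n : nat) : pred vertex :=
  [pred v | (v.2 == n%:Z) && (0 <= v.1 < m%:Z)].
Definition dual_bottom_vertex (m : nat) : pred vertex :=
  [pred v | (v.2 == -1) && (0 <= v.1 < m%:Z)].

Lemma first_edgeE (P : seq edge) : first_edge P = nth default_edge P 0.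
Proof. by rewrite nth0. Qed.

Lemma last_edgeE (P : seq edge) : last_edge P = nth default_edge P (size P).-1.
Proof. by rewrite nth_last. Qed.

Lemma self_avoiding_gt0 (P : seq edge) : self_avoiding P -> (0 < size P)%N.
Proof. by case: P => [[]|]. Qed.

(** All vertices lie in the rectangle and only [f 0] is on the left side, so every later edge lies
    strictly to the right of that side; the right side is symmetric. *)
Lemma crossing_of_link (R : realType) (m n : nat) (P : seq edge) :
  link (left_vertex n) (right_vertex m n) P -> all (primal_usable m n) P ->
  left_right_crossing R m n P.
Proof.
move=> [f [saP [f0 fA] [fk fB] fj]] uP; have k0 := self_avoiding_gt0 saP.
have ends i : (i < size P)%N -> endvertices (nth default_edge P i) =i [:: f i; f i.+1].
  by move=> ik; apply: joins_mem; apply: fj.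
have box e v : e \in P -> v \in endvertices e ->
    (0 <= v.1 <= m%:Z) && (0 <= v.2 <= n%:Z).
  by move=> /(allP uP) /allP h /h.
rewrite /left_right_crossing /crossing first_edgeE last_edgeE; split=> //.
- split.
    exists (f 0%N); split.
      by rewrite (ends 0%N) // mem_head left_sideE.
    move=> v []; rewrite (ends 0%N) // !inE left_sideE => /orP[] /eqP-> // h.
    by case/negP: (fA 1%N k0).
  move=> e eP; have /(nthP default_edge)[i ik ie] := eP; rewrite -{1 2}ie => ne.
  have i0 : (0 < i)%N by case: i ne {ik ie} => //; rewrite eqxx.
  apply: segment_left => v ve; have := box e v; rewrite eP -ie => /(_ isT ve).
  move: ve; rewrite ends // !inE => /orP[] /eqP->.
    by have := fA i; rewrite i0 (ltnW ik) => /(_ isT); rewrite /left_vertex;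
      case: (f i) => a b /=; lia.
  by have := fA i.+1 ik; rewrite /left_vertex; case: (f i.+1) => a b /=; lia.
- split.
    exists (f (size P)); split.
      by rewrite (ends (size P).-1) prednK // !inE eqxx orbT right_sideE.
    move=> v []; rewrite (ends (size P).-1) prednK // !inE right_sideE => /orP[] /eqP-> // h.
    have pk : ((size P).-1 < size P)%N by rewrite prednK.
    by case/negP: (fB _ pk).
  move=> e eP; have /(nthP default_edge)[i ik ie] := eP; rewrite -{1 2}ie => ne.
  have i0 : (i.+1 < size P)%N.
    by rewrite ltn_neqAle ik andbT; apply: contra_neq ne => <-.
  apply: segment_right => v ve; have := box e v; rewrite eP -ie => /(_ isT ve).
  move: ve; rewrite ends // !inE => /orP[] /eqP->.
    by have := fB i ik; rewrite /right_vertex; case: (f i) => a b /=; lia.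
  by have := fB i.+1 i0; rewrite /right_vertex; case: (f i.+1) => a b /=; lia.
- by move=> e eP _ _ v ve; rewrite rectangleE; apply: box eP ve.
Qed.

Lemma joins_adj (e : edge) (u v : vertex) : joins e u v ->
  (u.1 = v.1 /\ (v.2 = u.2 + 1 \/ u.2 = v.2 + 1)) \/
  (u.2 = v.2 /\ (v.1 = u.1 + 1 \/ u.1 = v.1 + 1)).
Proof.
case: e => [[x y] []] /joinsE; rewrite /start_vertex /end_vertex /=;
  by case=> -[-> ->] /=; lia.
Qed.

Lemma self_avoiding_index (P : seq edge) : self_avoiding P ->
  exists v vs, walk v vs P /\ exists f : nat -> vertex,
   [/\ f 0%N = v, f (size P) = last v vs &
      forall i, (i < size P)%N -> joins (nth default_edge P i) (f i) (f i.+1)].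
Proof.
case=> _ _ [v [vs [_ wP]]]; exists v, vs; split=> //; have [sz h] := walk_nth wP.
exists (nth v (v :: vs)); split=> //.
by rewrite -sz -[nth _ _ _]/(nth v (v :: vs) (size (v :: vs)).-1) nth_last.
Qed.

(* A crossing consisting of a single edge has no orientation, hence the second alternative. *)
Lemma walk_of_crossing (R : realType) (m n : nat) (P : seq edge) : (0 < m)%N ->
  left_right_crossing R m n P ->
  exists v vs, [/\ walk v vs P, all (primal_usable m n) P &
    left_vertex n v /\ right_vertex m n (last v vs) \/
    right_vertex m n v /\ left_vertex n (last v vs)].
Proof.
move=> m0 [saP]; have k0 := self_avoiding_gt0 saP; have [_ uP _] := saP.
have [v [vs [wP [f [f0 fk fj]]]]] := self_avoiding_index saP.
rewrite first_edgeE last_edgeE.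
move=> [[a [[ae /left_sideE aL] _]] nL] [[b [[be /right_sideE bR] _]] nR] mid.
exists v, vs; rewrite -fk.
have ends i : (i < size P)%N -> endvertices (nth default_edge P i) =i [:: f i; f i.+1].
  by move=> ik; apply: joins_mem; apply: fj.
have neq i j : (i < size P)%N -> (j < size P)%N -> i != j ->
    nth default_edge P i != nth default_edge P j by move=> ? ?; rewrite nth_uniq.
(* An inner vertex belongs to edge [i], which is not the first, and to edge [i.-1], which is not the
   last. *)
have midf i : (0 < i)%N -> (i < size P)%N -> ~~ left_vertex n (f i) /\
    ~~ right_vertex m n (f i).
  move=> i0 ik; split; apply/negP => fi.
    apply: (nL _ (mem_nth _ ik) (neq _ _ ik k0 _)); first by rewrite -lt0n.
    exists (Gd_point R (f i)); split; last by apply/left_sideE.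
    by apply: endvertex_segment; rewrite ends ?mem_head.
  have ik' : (i.-1 < size P)%N by lia.
  apply: (nR _ (mem_nth _ ik') (neq _ _ ik' _ _)); [lia | lia |].
  exists (Gd_point R (f i)); split; last by apply/right_sideE.
  by apply: endvertex_segment; rewrite ends // prednK // !inE eqxx orbT.
have sides : left_vertex n (f 0%N) /\ right_vertex m n (f (size P)) \/
    right_vertex m n (f 0%N) /\ left_vertex n (f (size P)).
  have pk : ((size P).-1 < size P)%N by rewrite prednK.
  move: ae be; rewrite !ends // prednK // !inE.
  (* A single edge may be traversed either way, and its ends on the two sides differ since [0 < m].
     With more edges, [midf] leaves only the outer ends. *)
  have [k1 | k1] := leqP (size P) 1.
    have -> : size P = 1%N by lia.
    move=> /orP[] /eqP ea /orP[] /eqP eb; subst a b; [|by left|by right|];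
      by move: aL bR m0; case: (f _) => x y /=; lia.
  have [/negP nl1 _] := midf 1%N isT k1.
  have [_ /negP nr1] : ~~ left_vertex n (f (size P).-1) /\ ~~ right_vertex m n (f (size P).-1).
    by apply: midf => //; lia.
  by move=> /orP[] /eqP ea /orP[] /eqP eb; subst a b => //; left.
have box i : (i <= size P)%N -> (0 <= (f i).1 <= m%:Z) && (0 <= (f i).2 <= n%:Z).
  move=> ik; have [i0 | i0] := posnP i.
    by subst i; move: sides; rewrite /left_vertex /right_vertex;
      case: (f 0%N) (f (size P)) => x y [x' y'] /=; lia.
  have [ie | ine] := eqVneq i (size P).
    by subst i; move: sides; rewrite /left_vertex /right_vertex;
      case: (f 0%N) (f (size P)) => x y [x' y'] /=; lia.
  have ilt : (i < size P)%N by lia.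
  (* With at least three edges, every inner vertex is an end of a middle edge. With two, the inner
     vertex is adjacent to a left and to a right vertex and lies on neither side, which forces it
     into the rectangle. *)
  have [k3 | k3] := leqP 3 (size P).
    have [j [jlt j0 jne fij]] : exists j, [/\ (j < size P)%N, j != 0%N, j != (size P).-1 &
        f i \in [:: f j; f j.+1]].
      have [il | il] := ltnP i (size P).-1.
        by exists i; split; rewrite ?mem_head; lia.
      by exists i.-1; split; rewrite ?prednK ?inE ?eqxx ?orbT; lia.
    apply/(rectangleE R); apply: (mid _ (mem_nth default_edge jlt)).
    - exact: neq.
    - by apply: neq => //; lia.
    - by rewrite ends.
  have k2 : size P = 2%N by lia.
  have i1 : i = 1%N by lia.
  subst i; move: sides (midf 1%N isT ilt) (joins_adj (fj 0%N k0)) (joins_adj (fj 1%N ilt)).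
  rewrite k2 /left_vertex /right_vertex.
  by case: (f 0%N) (f 1%N) (f 2%N) => ? ? [? ?] [? ?] /=; lia.
split=> //; last by rewrite -f0.
apply/allP => e /(nthP default_edge)[i ik <-].
apply/allP => u; rewrite ends // !inE => /orP[] /eqP->; apply: box; rewrite // ltnW //.
Qed.

(** By [meet_dual_edge], an edge of G meeting a horizontal edge in row [c] is its dual, which is
    vertical and starts half a unit lower, in dual row [c - 1]. *)
Lemma G_intersects_horizontal (R : realType) (m : nat) (c : int) (g : edge) :
  G_intersects g (`[0, (m%:R : R)] `*` [set c%:~R]) <->
  exists2 x : int, 0 <= x < m%:Z & g = ((x, c - 1), Vertical).
Proof.
split=> [[e [/segment_horizontal[]]]|[x /andP[x0 xm] ->]].
  rewrite setIC => h1 /intr_inj h2 h3 h4 /meet_dual_edge ->; move: h1 h2 h3 h4.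
  by case: e => [[x y] d] /= -> -> x0 xm; exists x; rewrite ?x0.
exists ((x, c), Horizontal); split; first by apply/segment_horizontal.
by rewrite setIC; apply/meet_dual_edge.
Qed.

Lemma dual_crossing_of_link (R : realType) (m n : nat) (Q : seq edge) :
  link (dual_top_vertex m n) (dual_bottom_vertex m) Q -> all (dual_usable m n) Q ->
  dual_top_bottom_crossing R m n Q.
Proof.
move=> [f [saQ [f0 fA] [fk fB] fj]] uQ; have k0 := self_avoiding_gt0 saQ.
have pk : ((size Q).-1 < size Q)%N by rewrite prednK.
have ends i : (i < size Q)%N -> endvertices (nth default_edge Q i) =i [:: f i; f i.+1].
  by move=> ik; apply: joins_mem; apply: fj.
have use i : (i < size Q)%N -> dual_usable m n (nth default_edge Q i).
  by move=> ik; apply: (allP uQ); apply: mem_nth.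
rewrite /dual_top_bottom_crossing /dual_crossing first_edgeE last_edgeE; split=> //.
(* The only usable edge at a vertex of dual row [n] is the vertical one from row [n - 1]. The bottom
   case mirrors this. *)
- apply/(@G_intersects_horizontal R m n%:Z).
  have := fA 1%N k0; have := joinsE (fj 0%N k0); have := use 0%N k0.
  move: f0; case: (nth _ Q 0) => [[x y] d]; rewrite /dual_usable /dual_top_vertex.
  move: (f 0%N) (f 1%N) => [a b] [a' b'] /=; rewrite /start_vertex /end_vertex /=.
  move=> fz u j nf1; exists a; first by move: fz; lia.
  by case: d u j => /= u [] [[? ?] [? ?]]; try (exfalso; lia); congr (_, _, _); lia.
- apply/(@G_intersects_horizontal R m 0).
  have := fB _ pk; have := joinsE (fj _ pk); have := use _ pk.
  rewrite prednK //; move: fk; case: (nth _ Q _) => [[x y] d].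
  rewrite /dual_usable /dual_bottom_vertex.
  move: (f (size Q)) (f (size Q).-1) => [a b] [a' b'] /=; rewrite /start_vertex /end_vertex /=.
  move=> fz u j nf1; exists a; first by move: fz; lia.
  by case: d u j => /= u [] [[? ?] [? ?]]; try (exfalso; lia); congr (_, _, _); lia.
- move=> g /(nthP default_edge)[i ik <-] ne0 nek v.
  have i0 : (0 < i)%N by case: i ne0 {ik nek} => //; rewrite eqxx.
  have i1 : (i.+1 < size Q)%N.
    by rewrite ltn_neqAle ik andbT; apply: contra_neq nek => <-.
  have := use i ik; have := joinsE (fj i ik); rewrite ends // => j u vj.
  apply/interiorE; move: vj.
  (* Ends of usable edges lie in the interior unless they are in row [n] or [-1], and inner vertices
     of a link avoid both rows. *)
  have /andP[] : ~~ dual_top_vertex m n (f i) && ~~ dual_bottom_vertex m (f i).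
    by rewrite fA ?fB // i0 ltnW.
  have /andP[] : ~~ dual_top_vertex m n (f i.+1) && ~~ dual_bottom_vertex m (f i.+1).
    by rewrite fA ?fB.
  move: u j; case: (nth _ Q i) => [[x y] d].
  rewrite /dual_usable /dual_bottom_vertex /dual_top_vertex.
  move: (f i) (f i.+1) => [a b] [a' b'] /=; rewrite /start_vertex /end_vertex /=.
  rewrite !inE => u j ? ? ? ? /orP[] /eqP-> /=;
  by case: d u j => /= u [] [[? ?] [? ?]]; lia.
Qed.

(** A dual crossing does not prescribe the sense in which its end edges are traversed; this follows
    once the second vertex is below row [n] and the last but one above row [-1]. *)
Lemma walk_of_dual_crossing (R : realType) (m n : nat) (Q : seq edge) : (0 < n)%N ->
  dual_top_bottom_crossing R m n Q ->
  exists w ws, [/\ walk w ws Q, all (dual_usable m n) Q, w.2 = n%:Z &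
    (last w ws).2 = -1].
Proof.
move=> n0 [saQ]; have k0 := self_avoiding_gt0 saQ; have [_ uQ _] := saQ.
have pk : ((size Q).-1 < size Q)%N by rewrite prednK.
have [v [vs [wQ [f [f0 fk fj]]]]] := self_avoiding_index saQ.
rewrite first_edgeE last_edgeE.
move=> /(@G_intersects_horizontal R m n)[x xm e0].
move=> /(@G_intersects_horizontal R m 0)[x' xm' ek] mid.
have ends i : (i < size Q)%N -> endvertices (nth default_edge Q i) =i [:: f i; f i.+1].
  by move=> ik; apply: joins_mem; apply: fj.
have inn i : (0 < i)%N -> (i.+1 < size Q)%N ->
    forall v, v \in endvertices (nth default_edge Q i) ->
    (0 <= v.1 < m%:Z) && (0 <= v.2 < n%:Z).
  move=> i0 ik u ui; have ik' := ltnW ik; apply/(interiorE R).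
  apply: mid ui; rewrite ?mem_nth // nth_uniq // -?lt0n //.
  by rewrite -eqSS prednK // neq_ltn ik.
have use i : (i < size Q)%N -> dual_usable m n (nth default_edge Q i).
  move=> ik; have [i0 | i0] := posnP i.
    by rewrite i0 e0 /dual_usable /=; lia.
  have [i1 | i1] := ltnP i.+1 (size Q).
    have := inn i i0 i1; case: (nth _ Q i) => [[a b] d] h.
    have := h _ (mem_head _ _); have /h : end_vertex (a, b, d) \in endvertices (a, b, d).
      by rewrite !inE eqxx orbT.
    by rewrite /dual_usable /start_vertex /end_vertex; case: d {h} => /=; lia.
  have -> : i = (size Q).-1 by apply/eqP; rewrite -eqSS prednK // eqn_leq ik.
  by rewrite ek /dual_usable /=; lia.
(* A single edge would have its lower end in row [n - 1] and in row [-1], which [0 < n] excludes. *)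
have [k1 | k1] := leqP (size Q) 1.
  have k1' : size Q = 1%N by apply/eqP; rewrite eqn_leq k1.
  by move: e0 ek; rewrite k1' /= => -> []; lia.
have f1 : (f 1%N).2 < n%:Z.
  have f1e : f 1%N \in endvertices (nth default_edge Q 1) by rewrite ends // mem_head.
  have [k2 | k2] := ltnP 2 (size Q); first by have /andP[_ /andP[]] := inn 1%N isT k2 _ f1e.
  have k2' : size Q = 2%N by apply/eqP; rewrite eqn_leq k1 k2.
  move: ek f1e; rewrite k2' /= => ->; rewrite /endvertices !inE => /orP[] /eqP -> /=; lia.
have fk1 : 0 <= (f (size Q).-1).2.
  have pk1 : ((size Q).-2.+1 < size Q)%N by case: (size Q) k1 => [|[]].
  have fe : f (size Q).-1 \in endvertices (nth default_edge Q (size Q).-2).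
    rewrite ends ?(ltnW pk1) // -[in f (size Q).-1](@prednK (size Q).-1) ?inE ?eqxx ?orbT //.
    by case: (size Q) k1 => [|[]].
  have [p0 | p0] := posnP (size Q).-2; last by have /andP[_ /andP[]] := inn _ p0 pk1 _ fe.
  move: fe; rewrite p0 e0 /endvertices !inE => /orP[] /eqP -> /=; lia.
exists v, vs; rewrite -fk -f0; split=> //.
- by rewrite f0.
- by apply/allP => e /(nthP default_edge)[i ik <-]; apply: use.
- have := joinsE (fj _ k0); rewrite e0 /start_vertex /end_vertex /=.
  by move=> [] [-> h]; move: f1; rewrite h /=; lia.
- have := joinsE (fj _ pk); rewrite prednK // ek /start_vertex /end_vertex /=.
  by move=> [] [h ->]; move: fk1; rewrite h /=; lia.
Qed.

(** * The dichotomy for open left right crossings *)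

Lemma walk_constant (c : pred vertex) (v : vertex) (vs : seq vertex) (P : seq edge) :
  walk v vs P -> (forall e, e \in P -> c (start_vertex e) = c (end_vertex e)) ->
  c v = c (last v vs).
Proof.
elim: vs v P => [|w vs IH] v [|e P] //= /andP[/joinsE ev wP] ce.
rewrite -(IH _ _ wP) => [|f fP]; last by apply: ce; rewrite inE fP orbT.
by case: ev (ce e (mem_head _ _)) => -[-> ->].
Qed.

Lemma primal_usable_primal_edge (m n : nat) (g : edge) :
  dual_usable m n g -> primal_usable m n (primal_edge g).
Proof.
by case: g => [[x y] []];
  rewrite /dual_usable /primal_usable /start_vertex /end_vertex /=; lia.
Qed.

Lemma left_right_duality (R : realType) (m n : nat) (st : configuration) :
  (0 < m)%N -> (0 < n)%N ->
  exactly_one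
    (exists P : seq edge, left_right_crossing R m n P /\ all_open st P)
    (exists P : seq edge,
      dual_top_bottom_crossing R m n P /\ all_closed (dual_configuration st) P).
Proof.
move=> m0 n0; split.
- have dl v : left_vertex n v -> ~~ right_vertex m n v.
    by case: v => x y; rewrite /left_vertex /right_vertex /=; lia.
  have dt v : dual_top_vertex m n v -> ~~ dual_bottom_vertex m v.
    by case: v => x y; rewrite /dual_top_vertex /dual_bottom_vertex /=; lia.
  have [[P lP]|[s [sL sR sE]]] := link_or_cut (predI (primal_usable m n) st) dl.
    rewrite all_predI => /andP[uP /allP oP]; left; exists P; split=> //.
    exact: crossing_of_link.
  have [[Q lQ]|[t [tT tB tE]]] :=
      link_or_cut (predI (dual_usable m n) (predC (dual_configuration st))) dt.
    rewrite all_predI => /andP[uQ /allP oQ]; right; exists Q; split.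
      exact: dual_crossing_of_link.
    by move=> e /oQ /negbTE.
  exfalso; apply: (no_two_cuts (m := m) (n := n) (s := s) (t := t)).
  + by move=> y h; apply: sL; rewrite /left_vertex /= h.
  + by move=> y h; apply: sR; rewrite /right_vertex /= eqxx h.
  + by move=> x h; apply: tT; rewrite /dual_top_vertex /= eqxx h.
  + by move=> x h; apply: tB; rewrite /dual_bottom_vertex /= h.
  + move=> g ug sg; apply: tE; rewrite /= ug /=.
    apply: contraNN sg => og; apply/eqP; apply: sE.
    by rewrite /= primal_usable_primal_edge.
- move=> [[P [cP oP]] [Q [cQ clQ]]].
  have [v [vs [wP uP ends]]] := walk_of_crossing m0 cP.
  have [w [ws [wQ uQ wn wl]]] := walk_of_dual_crossing n0 cQ.
  have [c [c0 cm ce]] := dual_walk_coloring wQ uQ wn wl.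
  (* An edge of the open walk whose dual lies in [Q] would be open and closed at once, so [c] is
     constant along the walk. *)
  have : c v = c (last v vs).
    apply: walk_constant wP _ => e eP; apply: ce; first exact: (allP uP).
    by apply/negP => /clQ; rewrite dual_configurationE oP.
  have cL u : left_vertex n u -> c u = false.
    by case: u => x y; rewrite /left_vertex /= => /andP[/eqP-> _].
  have cR u : right_vertex m n u -> c u = true.
    by case: u => x y; rewrite /right_vertex /= => /andP[/eqP-> /cm].
  by case: ends => -[h h']; [rewrite (cL _ h) (cR _ h') | rewrite (cL _ h') (cR _ h)].
Qed.

(** * Reversal and transposition *)

(** Transposition carries left to bottom and right to top, whereas vertical crossings run from top
    to bottom; reversal makes up for this. *)
Lemma crossing_rev (R : realType) (m n : nat) (A B : set (R * R)) (P : seq edge) :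
  crossing m n A B P -> crossing m n B A (rev P).
Proof.
have fl (Q : seq edge) : first_edge (rev Q) = last_edge Q.
  by case/lastP: Q => // Q e; rewrite rev_rcons /first_edge /last_edge last_rcons.
have lf : last_edge (rev P) = first_edge P by rewrite -fl revK.
move=> [saP [A1 A2] [B1 B2] mid]; rewrite /crossing fl lf; split.
- exact: self_avoiding_rev.
- by split=> // e; rewrite mem_rev; apply: B2.
- by split=> // e; rewrite mem_rev; apply: A2.
- by move=> e; rewrite mem_rev => *; apply: (mid e).
Qed.

Lemma dual_crossing_rev (R : realType) (m n : nat) (A B : set (R * R)) (P : seq edge) :
  dual_crossing m n A B P -> dual_crossing m n B A (rev P).
Proof.
have fl (Q : seq edge) : first_edge (rev Q) = last_edge Q.
  by case/lastP: Q => // Q e; rewrite rev_rcons /first_edge /last_edge last_rcons.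
have lf : last_edge (rev P) = first_edge P by rewrite -fl revK.
move=> [saP A1 B1 mid]; rewrite /dual_crossing fl lf; split=> //.
- exact: self_avoiding_rev.
- by move=> e; rewrite mem_rev => *; apply: (mid e).
Qed.

Definition swap (T : Type) (p : T * T) : T * T := (p.2, p.1).

Definition transpose_edge (e : edge) : edge :=
  (swap e.1, if e.2 is Horizontal then Vertical else Horizontal).

Lemma swapK (T : Type) : involutive (@swap T).
Proof. by case. Qed.

Lemma transpose_edgeK : involutive transpose_edge.
Proof. by case=> [[x y] []]. Qed.

Lemma endvertices_transpose (e : edge) :
  endvertices (transpose_edge e) = map (@swap int) (endvertices e).
Proof. by case: e => [[x y] []]. Qed.

Lemma mem_endvertices_transpose (e : edge) (v : vertex) :
  (v \in endvertices (transpose_edge e)) = (swap v \in endvertices e).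
Proof.
by rewrite endvertices_transpose -{1}[v]swapK mem_map //; apply: inv_inj; apply: swapK.
Qed.

Lemma joins_transpose (e : edge) (u v : vertex) :
  joins (transpose_edge e) (swap u) (swap v) = joins e u v.
Proof.
have inj : injective (map (@swap int)).
  by apply: inj_map; apply: inv_inj; apply: swapK.
by rewrite /joins endvertices_transpose -[[:: _; _] in LHS]/(map (@swap int) [:: _; _])
  -[X in _ || (_ == X)]/(map (@swap int) [:: v; u]) !(inj_eq inj).
Qed.

Lemma self_avoiding_transpose (P : seq edge) :
  self_avoiding P -> self_avoiding (map transpose_edge P).
Proof.
move=> [P0 uP [v [vs [uvs wP]]]]; split.
- by case: P P0 {uP wP}.
- by rewrite map_inj_uniq //; apply: inv_inj; apply: transpose_edgeK.
- exists (swap v), (map (@swap int) vs); split.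
    by rewrite -map_cons map_inj_uniq //; apply: inv_inj; apply: swapK.
  elim: vs v P wP {P0 uP uvs} => [|w vs IH] v [|e P] //= /andP[ev /IH ->].
  by rewrite joins_transpose ev.
Qed.

(** The shift by [(c, c)] is symmetric in the coordinates, so one reflection serves both
    lattices. *)
Lemma segment_transpose (R : realType) (c : R) (e : edge) (p : R * R) :
  segment c (transpose_edge e) p <-> segment c e (swap p).
Proof.
case: e => [[x y] []]; split=> -[t t01 pe]; exists t => //; move: pe;
  by case: p => a b; rewrite /swap /= => -[-> ->].
Qed.

Lemma first_edge_transpose (P : seq edge) : P <> [::] ->
  first_edge (map transpose_edge P) = transpose_edge (first_edge P).
Proof. by case: P. Qed.

Lemma last_edge_transpose (P : seq edge) : P <> [::] ->
  last_edge (map transpose_edge P) = transpose_edge (last_edge P).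
Proof. by case: P => // e P _; rewrite /last_edge /= last_map. Qed.

Lemma crossing_transpose (R : realType) (m n : nat) (A B : set (R * R)) (P : seq edge) :
  crossing m n A B P ->
  crossing n m (@swap R @^-1` A) (@swap R @^-1` B) (map transpose_edge P).
Proof.
have one e (C : set (R * R)) : one_endvertex_in e C ->
    one_endvertex_in (transpose_edge e) (@swap R @^-1` C).
  move=> [v [[ve vC] uv]]; exists (swap v); split.
    by rewrite mem_endvertices_transpose swapK; split=> //; case: (v) vC.
  by move=> w; rewrite mem_endvertices_transpose => /uv ->; rewrite swapK.
have meet e (C : set (R * R)) : Gd_intersects (transpose_edge e) (@swap R @^-1` C) ->
    Gd_intersects e C.
  by move=> [p [/segment_transpose pe pC]]; exists (swap p).
have inj := inv_inj transpose_edgeK.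
move=> [saP [A1 A2] [B1 B2] mid]; have [P0 _ _] := saP.
rewrite /crossing first_edge_transpose // last_edge_transpose //; split.
- exact: self_avoiding_transpose.
- split; first exact: one.
  by move=> _ /mapP[e eP ->]; rewrite (inj_eq inj) => ne /meet; apply: A2.
- split; first exact: one.
  by move=> _ /mapP[e eP ->]; rewrite (inj_eq inj) => ne /meet; apply: B2.
- move=> _ /mapP[e eP ->]; rewrite !(inj_eq inj) => ne1 ne2 v.
  by rewrite mem_endvertices_transpose => /(mid e eP ne1 ne2)[].
Qed.

Lemma dual_crossing_transpose (R : realType) (m n : nat) (A B : set (R * R))
    (P : seq edge) :
  dual_crossing m n A B P ->
  dual_crossing n m (@swap R @^-1` A) (@swap R @^-1` B) (map transpose_edge P).
Proof.
have meet f (C : set (R * R)) : G_intersects f C ->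
    G_intersects (transpose_edge f) (@swap R @^-1` C).
  move=> [e [eC [p [pf pe]]]]; exists (transpose_edge e); split.
    by move=> q /segment_transpose /eC.
  by exists (swap p); split; apply/segment_transpose; rewrite swapK.
have inj := inv_inj transpose_edgeK.
move=> [saP A1 B1 mid]; have [P0 _ _] := saP.
rewrite /dual_crossing first_edge_transpose // last_edge_transpose //; split.
- exact: self_avoiding_transpose.
- exact: meet.
- exact: meet.
- move=> _ /mapP[e eP ->]; rewrite !(inj_eq inj) => ne1 ne2 v.
  by rewrite mem_endvertices_transpose => /(mid e eP ne1 ne2)[].
Qed.

Lemma sides_transpose (R : realType) (m n : nat) :
  [/\ @swap R @^-1` left_side n = bottom_side n,
      @swap R @^-1` right_side m n = top_side n m,
      @swap R @^-1` bottom_side m = left_side m &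
      @swap R @^-1` top_side m n = right_side n m].
Proof. by split; apply/seteqP; split=> -[a b] /= []. Qed.

Lemma primal_edge_transpose (g : edge) :
  primal_edge (transpose_edge g) = transpose_edge (primal_edge g).
Proof. by case: g => [[x y] []]. Qed.

Lemma left_right_crossing_transpose (R : realType) (m n : nat) (P : seq edge) :
  left_right_crossing R n m P ->
  top_bottom_crossing R m n (rev (map transpose_edge P)).
Proof.
by move=> /crossing_transpose /crossing_rev; have [-> _ _ _] := sides_transpose R n m;
  have [_ -> _ _] := sides_transpose R n m.
Qed.

Lemma top_bottom_crossing_transpose (R : realType) (m n : nat) (P : seq edge) :
  top_bottom_crossing R m n P ->
  left_right_crossing R n m (rev (map transpose_edge P)).
Proof.
by move=> /crossing_transpose /crossing_rev; have [_ _ -> _] := sides_transpose R m n;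
  have [_ _ _ ->] := sides_transpose R m n.
Qed.

Lemma dual_left_right_crossing_transpose (R : realType) (m n : nat) (P : seq edge) :
  dual_left_right_crossing R n m P ->
  dual_top_bottom_crossing R m n (rev (map transpose_edge P)).
Proof.
by move=> /dual_crossing_transpose /dual_crossing_rev;
  have [-> -> _ _] := sides_transpose R n m.
Qed.

Lemma dual_top_bottom_crossing_transpose (R : realType) (m n : nat) (P : seq edge) :
  dual_top_bottom_crossing R m n P ->
  dual_left_right_crossing R n m (rev (map transpose_edge P)).
Proof.
by move=> /dual_crossing_transpose /dual_crossing_rev;
  have [_ _ -> ->] := sides_transpose R m n.
Qed.

Theorem theorem4 (R : realType) (m n : nat) (hm : (1 <= m)%N) (hn : (1 <= n)%N)
    (st : configuration) :
  exactly_one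
    (exists P : seq edge, left_right_crossing R m n P /\ all_open st P)
    (exists P : seq edge,
      dual_top_bottom_crossing R m n P /\ all_closed (dual_configuration st) P)
  /\
  exactly_one
    (exists P : seq edge,
      dual_left_right_crossing R m n P /\ all_open (dual_configuration st) P)
    (exists P : seq edge, top_bottom_crossing R m n P /\ all_closed st P).
Proof.
split; first exact: left_right_duality.
(* Under [st'], closed top bottom crossings become open left right crossings of the transposed
   rectangle, and open dual left right crossings become closed dual top bottom ones. *)
pose st' : configuration := fun e => ~~ st (transpose_edge e).
have mem P e : e \in rev (map transpose_edge P) -> transpose_edge e \in P.
  by rewrite mem_rev => /mapP[f fP ->]; rewrite transpose_edgeK.
have [ex nboth] := left_right_duality R st' hn hm; split.
- case: ex => -[P [cP sP]]; [right | left]; exists (rev (map transpose_edge P)).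
    split; first exact: left_right_crossing_transpose.
    by move=> e /mem /sP; rewrite /st' transpose_edgeK => /negbTE.
  split; first exact: dual_top_bottom_crossing_transpose.
  move=> e /mem /sP; rewrite /dual_configuration /st' primal_edge_transpose transpose_edgeK.
  by move=> /negbFE.
- move=> [[Q [cQ oQ]] [P [cP clP]]]; apply: nboth; split.
    exists (rev (map transpose_edge P)); split; first exact: top_bottom_crossing_transpose.
    by move=> e /mem /clP; rewrite /st' => ->.
  exists (rev (map transpose_edge Q)); split.
    exact: dual_left_right_crossing_transpose.
  move=> e /mem /oQ; rewrite /dual_configuration /st' primal_edge_transpose => ->.
  by [].
Qed.
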